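(* Let $f(x)=x^4+a_2x^2+a_1x+a_0$ be a monic depressed quartic polynomial with real coefficients, let $\mu$ be the Steklov function associated with $f$, and let $t>0$. Then $\mu(\cdot,t)$ is quasi-convex if, and only if, $$t\ge\frac12\sqrt{\max\left\{0,-\left(3\,a_1^{2/3}+2\,a_2\right)\right\}}.$$
   Context: The Steklov function associated with $f$ is $\mu(x,t):=\frac{1}{2t}\int_{x-t}^{x+t}f(\tau)\,d\tau$ for $x\in\mathbb{R}$, $t>0$. A function $h:\mathbb{R}\to\mathbb{R}$ is quasi-convex if for every $\alpha\in\mathbb{R}$ the set $\{x\in\mathbb{R}: h(x)\le\alpha\}$ is convex. Here $a_1^{2/3}:=(\sqrt[3]{a_1})^2$ with the real cube root. *)

(* Defs.v *)
From HB Require Import structures.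
From mathcomp Require Import all_boot all_order all_algebra.
From mathcomp Require Import all_classical all_reals all_analysis.

Set Implicit Arguments.
Unset Strict Implicit.
Unset Printing Implicit Defensive.

Import Order.TTheory GRing.Theory Num.Theory.
Import numFieldNormedType.Exports.

Local Open Scope classical_set_scope.
Local Open Scope ring_scope.

(* Intended for [0 < t] and [f] integrable on [x - t, x + t]. *)
Definition steklov (R : realType) (f : R -> R) (x t : R) : R :=
  (2 * t)^-1 * \int[lebesgue_measure]_(tau in `[x - t, x + t]) f tau.

(* [convex_set] wants a module over [R]: [R^o] is [R] as a module over itself. *)
Definition quasi_convex (R : realType) (h : R -> R) : Prop :=
  forall alpha : R, convex_set ([set x | h x <= alpha] : set R^o).

(* [powR] is only meaningful on nonnegative bases, hence the sign factor. *)
Definition cbrt (R : realType) (x : R) : R := Num.sg x * `|x| `^ 3^-1.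

Lemma cbrtK (R : realType) (x : R) : cbrt x ^+ 3 = x.
Proof.
rewrite /cbrt exprMn -(powR_mulrn 3 (powR_ge0 `|x| 3^-1)) -powRrM mulVf ?pnatr_eq0//.
rewrite powRr1 ?normr_ge0//; case: (ltrgt0P x) => [x0|x0|->].
- by rewrite gtr0_sg// expr1n mul1r.
- by rewrite ltr0_sg// -signr_odd/= expr1 mulN1r opprK.
- by rewrite mulr0.
Qed.

(* Main.v *)
Require Import Defs.
From mathcomp Require Import all_boot all_order all_algebra.
From mathcomp Require Import all_classical all_reals all_analysis.
From mathcomp Require Import ring lra.

Set Implicit Arguments.
Unset Strict Implicit.
Unset Printing Implicit Defensive.

Import Order.TTheory GRing.Theory Num.Theory.
Import numFieldNormedType.Exports.

Local Open Scope ring_scope.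

(** The Steklov mean of the quartic is again a depressed quartic, with the same
    linear coefficient and with quadratic coefficient [b = 2 t^2 + a2]
    ([steklov_quartic]).  With [a1 = c^3], the theorem becomes the claim that
    [h x = x^4 + b x^2 + c^3 x + d] is quasi-convex exactly when [0 <= e], where
    [e = 2 b + 3 c^2] ([quasi_convex_quarticP]).  Behind this lies the sign of
    the discriminant of [h']; writing it with the cube root [c] pays off because
    [h' x = (x + c) (2 x - c)^2 + e x].

    If [0 <= e], replacing [x] by [- x] reduces to the case [0 <= c].  Suppose
    that [h] is larger at [z] than at [x] and at [y], with [x < z < y].  Then
    the chord of [h] over [[x, z]] has positive slope and the one over [[z, y]]
    has negative slope.  A chord centred at a nonnegative abscissa has
    nonnegative slope, by the factorization above; so [z + y < 0], and comparing
    the formulas for the two slopes gives a contradiction ([quartic_le_max]).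

    If [e < 0], Taylor expansion at the double root [c / 2] of the critical case
    [e = 0] gives
    [h (c / 2 + v) - h (c / 2) = v^2 (v^2 + e / 2) + 2 c v (v^2 + e / 4)].
    For [u = sqrt (- e / 4)] the last term vanishes at [v = u] and at [v = - u],
    so that both values of [h] are equal to [h (c / 2) - u^4]: the midpoint
    [c / 2] lies strictly above the ends of the segment. *)

Lemma Rintegral_deriv_horner (R : realType) (p : {poly R}) (a b : R) :
  a < b ->
  \int[lebesgue_measure]_(x in `[a, b]) p^`().[x] = p.[b] - p.[a].
Proof.
move=> ab; rewrite /Rintegral (@continuous_FTC2 _ _ (horner p)) //.
- by apply: derivable_within_continuous => x _; exact: derivable_horner.
- split; first by move=> x _; exact: derivable_horner.
  + exact/cvg_at_right_filter/continuous_horner.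
  + exact/cvg_at_left_filter/continuous_horner.
- by move=> x _; rewrite -derive.derivE.
Qed.

Lemma steklov_deriv_horner (R : realType) (p : {poly R}) (x t : R) :
  0 < t ->
  steklov (horner p^`()) x t = (2 * t)^-1 * (p.[x + t] - p.[x - t]).
Proof.
move=> t0; rewrite /steklov Rintegral_deriv_horner//.
by rewrite ltrD2l gtrN.
Qed.

Lemma steklov_quartic (R : realType) (a0 a1 a2 x t : R) : 0 < t ->
  steklov (fun x : R => x ^+ 4 + a2 * x ^+ 2 + a1 * x + a0) x t =
  x ^+ 4 + (2 * t ^+ 2 + a2) * x ^+ 2 + a1 * x
    + (t ^+ 4 / 5 + a2 * t ^+ 2 / 3 + a0).
Proof.
move=> t0.
pose p : {poly R} :=
  5^-1 *: 'X^5 + (a2 / 3) *: 'X^3 + (a1 / 2) *: 'X^2 + a0 *: 'X.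
have -> : (fun x : R => x ^+ 4 + a2 * x ^+ 2 + a1 * x + a0) = horner p^`().
  apply/funext => y; rewrite /p !(derivD, derivZ, derivXn, derivX).
  rewrite !(hornerD, hornerZ, hornerMn, hornerXn, hornerC) /=.
  by field.
rewrite steklov_deriv_horner// /p !(hornerD, hornerZ, hornerXn, hornerX); field.
by rewrite gt_eqF.
Qed.

Lemma quasi_convex_midpoint (R : realType) (h : R -> R) (x y : R) :
  quasi_convex h -> h ((x + y) / 2) <= Num.max (h x) (h y).
Proof.
have half01 : 0 <= 2^-1 :> R /\ 2^-1 <= 1 :> R by split; lra.
move=> /(_ (Num.max (h x) (h y)) x y (Itv01 half01.1 half01.2)).
rewrite !inE /= !le_max !lexx orbT /= -!le_max => /(_ isT isT).
set m := conv _ _ _; suff -> : m = (x + y) / 2 by [].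
by rewrite [m](_ : _ = 2^-1 * x + (1 - 2^-1) * y)//; field.
Qed.

Lemma quasi_convexI (R : realType) (h : R -> R) :
  (forall x z y, x < z < y -> h z <= Num.max (h x) (h y)) -> quasi_convex h.
Proof.
move=> hmax alpha x y l; rewrite !inE /= => hx hy.
wlog : x y l hx hy / x <= y.
  move=> wlg; case: (leP x y) => [|/ltW] xy; first exact: wlg.
  by rewrite convC; exact: wlg.
move=> /(convR_itv l); rewrite in_itv /=.
set z := conv _ _ _; rewrite -[h _]/(h z).
move=> /andP[]; rewrite le_eqVlt => /predU1P[<- //|xz].
rewrite le_eqVlt => /predU1P[-> //|zy].
by apply: le_trans (hmax x z y _) _; rewrite ?xz// ge_max hx.
Qed.

(** If it failed, the chord over [[x, z]] would have slope
    [(x + z) (x^2 + z^2 + b) + c^3 > 0] and the one over [[z, y]] slope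
    [(z + y) (z^2 + y^2 + b) + c^3 < 0].  The latter forces
    [x + z < z + y < 0], hence [y^2 < x^2] and
    [0 < z^2 + y^2 + b < x^2 + z^2 + b]; so the slope on the left would be the
    smaller of the two. *)
Lemma quartic_le_max (R : realFieldType) (b c d x z y : R) :
  let h := fun x : R => x ^+ 4 + b * x ^+ 2 + c ^+ 3 * x + d in
  0 <= c -> 0 <= 2 * b + 3 * c ^+ 2 -> x < z < y ->
  h z <= Num.max (h x) (h y).
Proof.
move=> h c0 e0 /andP[xz zy].
rewrite leNgt gt_max; apply/negP => /andP[hxz hyz].
have s1 : 0 < (x + z) * (x ^+ 2 + z ^+ 2 + b) + c ^+ 3.
  rewrite -(pmulr_rgt0 _ (_ : 0 < z - x)) ?subr_gt0//.
  rewrite [X in 0 < X](_ : _ = h z - h x) ?subr_gt0//.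
  by rewrite /h; ring.
have s2 : (z + y) * (z ^+ 2 + y ^+ 2 + b) + c ^+ 3 < 0.
  rewrite -(pmulr_rlt0 _ (_ : 0 < y - z)) ?subr_gt0//.
  rewrite [X in X < 0](_ : _ = h y - h z) ?subr_lt0//.
  by rewrite /h; ring.
have c30 : 0 <= c ^+ 3 by rewrite exprn_ge0.
have zy0 : z + y < 0.
  rewrite ltNge; apply/negP => n0; move: s2; rewrite ltNge => /negP; apply.
  (* The slope is [h' m + m (y - z)^2] at the centre [m = (z + y) / 2], and
     [h' m = (m + c) (2 m - c)^2 + e m]. *)
  rewrite [X in 0 <= X](_ : _ = ((z + y) / 2 + c) * (z + y - c) ^+ 2
    + (2 * b + 3 * c ^+ 2 + (y - z) ^+ 2) * ((z + y) / 2)); last by field.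
  have m0 : 0 <= (z + y) / 2 by rewrite divr_ge0.
  by rewrite addr_ge0 //; apply: mulr_ge0; rewrite ?sqr_ge0// addr_ge0 ?sqr_ge0.
have q2 : 0 < z ^+ 2 + y ^+ 2 + b.
  by rewrite -(nmulr_rlt0 _ zy0); lra.
(* Here [x < y < - z < - x], whence [x + y < 0]. *)
have xy : y ^+ 2 < x ^+ 2.
  by rewrite -subr_gt0 subr_sqr nmulr_rgt0; lra.
have : (x + z) * (x ^+ 2 + z ^+ 2 + b) < (z + y) * (z ^+ 2 + y ^+ 2 + b).
  rewrite -ltrN2 -!mulNr ltr_pM//; lra.
lra.
Qed.

Lemma quasi_convex_quartic (R : realType) (b c d : R) :
  0 <= 2 * b + 3 * c ^+ 2 ->
  quasi_convex (fun x : R => x ^+ 4 + b * x ^+ 2 + c ^+ 3 * x + d).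
Proof.
move=> e0; apply: quasi_convexI => x z y /andP[xz zy].
have [c0|/ltW c0] := leP 0 c; first by apply: quartic_le_max => //; rewrite xz.
have reflect w : (- w) ^+ 4 + b * (- w) ^+ 2 + (- c) ^+ 3 * (- w) + d =
  w ^+ 4 + b * w ^+ 2 + c ^+ 3 * w + d by ring.
have := @quartic_le_max R b (- c) d (- y) (- z) (- x).
rewrite /= !reflect oppr_ge0 sqrrN !ltrN2 xz zy maxC; exact.
Qed.

Lemma quasi_convex_quarticP (R : realType) (b c d : R) :
  quasi_convex (fun x : R => x ^+ 4 + b * x ^+ 2 + c ^+ 3 * x + d) <->
  0 <= 2 * b + 3 * c ^+ 2.
Proof.
split=> [qh|]; last exact: quasi_convex_quartic.
rewrite leNgt; apply/negP => e0.
pose e := 2 * b + 3 * c ^+ 2.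
pose u := Num.sqrt (- e / 4).
have u2 : u ^+ 2 = - e / 4 by rewrite sqr_sqrtr // /e; lra.
have u4 : 0 < u ^+ 4.
  by rewrite (exprM u 2 2) exprn_gt0// u2 /e; lra.
have := quasi_convex_midpoint (c / 2 - u) (c / 2 + u) qh.
have -> : (c / 2 - u + (c / 2 + u)) / 2 = c / 2 by field.
have bE : b = - 2 * u ^+ 2 - 3 / 2 * c ^+ 2 by rewrite u2 /e; field.
rewrite !bE.
set hm := _ + d; set hl := (X in Num.max X _); set hr := (X in Num.max _ X).
(* After [b] is eliminated, the expansion of the quartic at [c / 2] is
   [hm + v^2 (v^2 - 2 u^2) + 2 c v (v^2 - u^2)]. *)
have -> : hl = hm - u ^+ 4 by rewrite /hl /hm; field.
have -> : hr = hm - u ^+ 4 by rewrite /hr /hm; field.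
rewrite maxxx; lra.
Qed.

Theorem proposition4 (R : realType) (a0 a1 a2 t : R) (ht : 0 < t) :
  let f := fun x : R => x ^+ 4 + a2 * x ^+ 2 + a1 * x + a0 in
  quasi_convex (fun x : R => steklov f x t) <->
  t >= 2^-1 * Num.sqrt (Num.max 0 (- (3 * cbrt a1 ^+ 2 + 2 * a2))).
Proof.
move=> f.
have -> : (fun x => steklov f x t) = (fun x => x ^+ 4
    + (2 * t ^+ 2 + a2) * x ^+ 2 + cbrt a1 ^+ 3 * x
    + (t ^+ 4 / 5 + a2 * t ^+ 2 / 3 + a0)).
  by apply/funext => x; rewrite steklov_quartic// cbrtK.
rewrite quasi_convex_quarticP.
rewrite [2^-1 * _]mulrC ler_pdivrMr// -[t * 2]ger0_norm; last first.
  by rewrite mulr_ge0// ltW.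
rewrite -[`|_|]sqrtr_sqr ler_sqrt ?sqr_ge0// ge_max sqr_ge0 /= exprMn.
by split; lra.
Qed.
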